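(* Let $P_\beta(n)$ be defined by $\sum_{n=0}^{\infty}P_\beta(n)q^n=\beta(q)$, where $\beta(q)=\sum_{n=0}^{\infty}\dfrac{q^{3n^2+3n+1}}{(q;q^3)_{n+1}(q^2;q^3)_{n+1}}$. Then for every integer $n\ge 0$, $$P_\beta(3n+1)+\sum_{m=1}^{\infty}(-1)^mP_\beta\Big(3n-3m(3m+1)+1\Big)+\sum_{m=1}^{\infty}(-1)^mP_\beta\Big(3n-3m(3m-1)+1\Big)$$ $$=\sum_{k=0}^{\infty}(-1)^k(2k+1)\,\bar{p}\left(n-\frac{3k(k+1)}{2}\right)=\bar{p}(n)-3\bar{p}(n-3)+5\bar{p}(n-9)-\cdots.$$
   Context: Notation: $(b;q)_n=\prod_{k=0}^{n-1}(1-bq^k)$ and $\ell_k=\prod_{m\ge1}(1-q^{km})$. $\bar p(n)$ is the number of overpartitions of $n$, with $\sum_{n\ge0}\bar p(n)q^n=\ell_2/\ell_1^2$. The function $\beta(q)$ is a sixth order mock theta function. Convention: $P_\beta(m)=0$ and $\bar p(m)=0$ for $m<0$. *)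

(* Defs.v *)
From mathcomp Require Import all_boot all_order all_algebra finmap.
From mathcomp Require Import boolp classical_sets cardinality fsbigop.
From mathcomp Require Import zify.

Set Implicit Arguments.
Unset Strict Implicit.
Unset Printing Implicit Defensive.

Import GRing.Theory.
Local Open Scope ring_scope.

(* Formal power series over Z are given by their coefficient sequences
   [nat -> int]. *)

Definition qpoch (R : comNzRingType) (b q : R) (n : nat) : R :=
  \prod_(k < n) (1 - b * q ^+ k).

(* The n-th coefficient of the power series c / d, for a polynomial d with
   constant coefficient 1: as 1 - d is divisible by 'X, the powers (1 - d) ^+ k
   with k > n of 1 / d = \sum_k (1 - d) ^+ k do not contribute.
   See [fps_divP] and [fps_div_uniq]. *)
Definition fps_div (c d : {poly int}) (n : nat) : int :=
  (c * \sum_(k < n.+1) (1 - d) ^+ k)`_n.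

Lemma fps_div_trunc (c d : {poly int}) (n m : nat) : d`_0 = 1 -> (n <= m)%N ->
  fps_div c d n = (c * \sum_(k < m.+1) (1 - d) ^+ k)`_n.
Proof.
move=> d0; elim: m => [|m IHm]; first by rewrite leqn0 => /eqP->.
rewrite leq_eqVlt => /orP[/eqP-> //|lt_nm].
rewrite big_ord_recr /= mulrDr coefD -IHm //.
have /factor_theorem[v ->] : root (1 - d) 0.
  by apply/rootP; rewrite horner_coef0 coefB coef1 d0 subrr.
by rewrite subr0 exprMn mulrA coefMXn lt_nm addr0.
Qed.

Lemma fps_divP (c d : {poly int}) (n : nat) : d`_0 = 1 ->
  \sum_(i < n.+1) d`_i * fps_div c d (n - i) = c`_n.
Proof.
move=> d0; pose S := c * \sum_(k < n.+1) (1 - d) ^+ k.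
have -> : \sum_(i < n.+1) d`_i * fps_div c d (n - i) = (d * S)`_n.
  rewrite coefM; apply: eq_bigr => i _.
  by rewrite (@fps_div_trunc _ _ _ n d0) ?leq_subr.
have -> : d * S = c - c * (1 - d) ^+ n.+1.
  have := subrX1 (1 - d) n.+1; rewrite addrAC subrr add0r => e.
  by rewrite /S mulrCA -(opprK (d * _)) -mulNr -e opprB mulrBr mulr1.
have /factor_theorem[v ->] : root (1 - d) 0.
  by apply/rootP; rewrite horner_coef0 coefB coef1 d0 subrr.
by rewrite subr0 exprMn mulrA coefB coefMXn ltnSn subr0.
Qed.

Lemma fps_div_uniq (c d : {poly int}) (f : nat -> int) : d`_0 = 1 ->
  (forall n, \sum_(i < n.+1) d`_i * f (n - i)%N = c`_n) ->
  f =1 fps_div c d.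
Proof.
move=> d0 fP n; elim/ltn_ind: n => n IHn.
have := fP n; rewrite -(fps_divP c n d0) !big_ord_recl /= d0 !mul1r !subn0.
rewrite (eq_bigr (fun i : 'I_n =>
  d`_(lift ord0 i) * fps_div c d (n - lift ord0 i))); first exact: addIr.
by move=> i _; rewrite IHn //; move: (ltn_ord i); rewrite /= /bump; lia.
Qed.

Definition beta_den (k : nat) : {poly int} :=
  qpoch 'X 'X^3 k.+1 * qpoch 'X^2 'X^3 k.+1.

Lemma beta_den0 (k : nat) : (beta_den k)`_0 = 1.
Proof.
have qpoch0 (a m : nat) :
    (qpoch ('X^(a.+1) : {poly int}) 'X^3 m)`_0 = 1.
  rewrite -horner_coef0 /qpoch horner_prod big1 // => i _.
  by rewrite hornerD hornerN hornerM hornerXn hornerC exprS !mul0r subr0.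
have -> : beta_den k = qpoch 'X^1 'X^3 k.+1 * qpoch 'X^2 'X^3 k.+1 by [].
by rewrite -horner_coef0 hornerM !horner_coef0 !qpoch0 mulr1.
Qed.

Definition beta_term (k n : nat) : int :=
  fps_div 'X^(3 * k ^ 2 + 3 * k + 1) (beta_den k) n.

Lemma beta_term_eq0 (k n : nat) : (n < 3 * k ^ 2 + 3 * k + 1)%N ->
  beta_term k n = 0.
Proof. by move=> lt_n; rewrite /beta_term /fps_div coefXnM lt_n. Qed.

(* [\sum_(i \in A) F i] is 0 when F has infinite support on A; here only the
   k <= n contribute, see [beta_term_eq0]. *)
Definition P_beta (n : nat) : int := \sum_(k \in [set: nat]) beta_term k n.

(* In an overpartition x of n, x.1 i is the multiplicity of the part i + 1, and
   x.2 is the set of those i for which the first occurrence of the part i + 1 is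
   overlined. *)
Definition overpartitions (n : nat) :
    {set {ffun 'I_n -> 'I_n.+1} * {set 'I_n}} :=
  [set x : {ffun 'I_n -> 'I_n.+1} * {set 'I_n}
     | (\sum_(i < n) i.+1 * x.1 i == n)%N
     & x.2 \subset [set i | (0 < x.1 i)%N]]%SET.

Definition pbar (n : nat) : int := #|overpartitions n|%:Z.

Definition ext0 (f : nat -> int) (m : int) : int :=
  if m is Posz n then f n else 0.

(* Main.v *)
Require Import Defs.
From mathcomp Require Import all_boot all_order all_algebra finmap.
From mathcomp Require Import boolp classical_sets cardinality fsbigop.
From mathcomp Require Import zify ring.

Set Implicit Arguments.
Unset Strict Implicit.
Unset Printing Implicit Defensive.

Import GRing.Theory.
Local Open Scope ring_scope.

(** Write [(b; q)_n] for [qpoch b q n], [(q)_n] for [(q; q)_n], and let [N = oo]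
    mean that [N] is large. The two sums over [m] on the left combine with the
    leading term into the product of beta(q) by
    [\sum_m (-1)^m q^(3m(3m+1)) = (q^6; q^6)_oo], [m] running over the integers,
    by the pentagonal number theorem. On the right stands the coefficient of
    [q^n] in the product of the overpartition series [(q^2; q^2)_oo / (q)_oo^2]
    by [(q^3; q^3)_oo^3], by Jacobi's identity. So the theorem amounts to
    [\sum_n P_beta(3n+1) q^n = (q^3; q^3)_oo^3 / (q)_oo^2].

    This comes from the Lambert type expansion of beta. For [x y = q],
      [\sum_n q^(n(n+1)) / ((x; q)_(n+1) (y; q)_(n+1))
       = (q)_oo^-1 \sum_(j >= 0) (-1)^j q^(3j(j+1)/2) u_j],
      [u_j = 1 / (1 - x q^j) + y q^j / (1 - y q^j)],
    ([universal_mock_theta]), and beta is [q] times the left side for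
    [(x, y, q) := (q, q^2, q^3)]. Expanding [1 / (1 - t)] as
    [(1 + t + t^2) / (1 - t^3)] splits the right side by exponents modulo 3; the
    class which is needed again has the shape of the [u_j], with
    [(q^3, q^6, q^9)] in place of [(q, q^2, q^3)], and with the smaller
    exponents [j(j+1)/2] in base [q^9]. That sum is a product, by the expansion
      [\sum_(j >= 0) (-1)^j q^(j(j+1)/2) u_j
       = (q)_oo^2 / ((x; q)_oo (y; q)_oo)]
    of the reciprocal of a theta function ([reciprocal_theta]).

    All these series identities are limits of finite ones given by Bailey pairs
    relative to [q]: the unit pair gives the pentagonal number theorem, a pair
    with [j]-th term proportional to [2j+1] gives Jacobi's identity, and the
    partial fraction expansion of [1 / ((x; q)_(n+1) (y; q)_(n+1))] gives the
    other two. The first two pairs are instances of one recurrence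
    ([bailey_recurrence]), and the third one follows from the unit pair.

    The finite identities hold in any commutative ring where the [1 - q^k] are
    invertible. If moreover [q] is nilpotent, the limits become equalities, so
    that power series are handled in the truncations [rat[X] / X^(N+1)]. *)

(** * Bailey pairs *)

Lemma qpochS (R : comNzRingType) (b p : R) n :
  qpoch b p n.+1 = qpoch b p n * (1 - b * p ^+ n).
Proof. by rewrite /qpoch big_ord_recr. Qed.

Section BaileyPairs.
Variables (R : comUnitRingType) (q : R).
Hypothesis q_unit : forall k, 1 - q ^+ k.+1 \is a GRing.unit.

Definition qfactV n : R := (qpoch q q n)^-1.
Local Notation h := qfactV.

Lemma qfact_unit n : qpoch q q n \is a GRing.unit.
Proof. by apply: rpred_prod => i _; rewrite -exprS. Qed.

Lemma qfactV0 : h 0 = 1.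
Proof. by rewrite /h /qpoch big_ord0 invr1. Qed.

Lemma qfactVS n : h n = (1 - q ^+ n.+1) * h n.+1.
Proof. by rewrite /h qpochS -exprS invrM ?qfact_unit // mulrA mulrV ?mul1r. Qed.

(** A finite form of Cauchy's expansion of [1 / (q)_oo] along Durfee
    rectangles. It is an induction on [N], using the Pascal rule
    [1 - q^(N+1) = q^m (1 - q^(N+1-m)) + (1 - q^m)]: the two resulting sums
    recombine into the sum for [N] and [a + 1]. *)
Lemma cauchy_durfee N a :
  \sum_(m < N.+1) q ^+ (m * (m + a)) * (h m * h (N - m) * h (m + a)%N)
  = h N * h (N + a).
Proof.
elim: N a => [|N IHN] a; first by rewrite big_ord1 /= mul0n qfactV0; ring.
apply: (mulrI (q_unit N)); rewrite mulrA -qfactVS addSnnS -IHN mulr_sumr.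
rewrite (eq_bigr (fun m : 'I_N.+2 =>
   q ^+ (m * (m + a)) * (q ^+ m * (1 - q ^+ (N.+1 - m)))
     * (h m * h (N.+1 - m) * h (m + a)%N)
   + q ^+ (m * (m + a)) * (1 - q ^+ m)
     * (h m * h (N.+1 - m) * h (m + a)%N))); last first.
  move=> m _; rewrite -mulrDl -mulrDr mulrA [(1 - _) * _]mulrC.
  have -> : q ^+ N.+1 = q ^+ m * q ^+ (N.+1 - m).
    by rewrite -exprD subnKC // -ltnS.
  ring.
rewrite big_split /= big_ord_recr /= subnn expr0 subrr !mulr0 mul0r addr0.
rewrite [X in _ + X]big_ord_recl /= expr0 subrr !mulr0 mul0r add0r -big_split /=.
apply: eq_bigr => m _; rewrite subSS subSn -1?ltnS // !addnS addSn.
rewrite (qfactVS (N - m)) (qfactVS m) (qfactVS (m + a)).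
have -> : (m.+1 * (m + a).+1 = m * (m + a).+1 + (m + a).+1)%N by lia.
have -> : (m * (m + a).+1 = m * (m + a) + m)%N by lia.
rewrite !exprD.
ring.
Qed.

(** Bailey pairs relative to [q], in the usual normalization
    [1 / ((q)_(n-j) (q^2; q)_(n+j))] up to the constant factor [1 - q]. *)
Definition bailey_pair (alpha beta : nat -> R) := forall n,
  beta n = \sum_(j < n.+1) alpha j * (h (n - j) * h (n + j).+1).

(** Bailey's lemma with both parameters sent to infinity. After exchanging the
    sums, the inner one is [cauchy_durfee] for [a = 2j + 1]. *)
Lemma bailey_lemma alpha beta N : bailey_pair alpha beta ->
  \sum_(n < N.+1) q ^+ (n * n.+1) * h (N - n) * beta n
  = \sum_(j < N.+1) q ^+ (j * j.+1) * alpha j * (h (N - j) * h (N + j).+1).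
Proof.
move=> ab.
under eq_bigr => n _.
  rewrite ab mulr_sumr (big_ord_widen N.+1
    (fun j => q ^+ (n * n.+1) * h (N - n) * (alpha j * (h (n - j) * h (n + j).+1)))) //.
  over.
rewrite (exchange_big_dep xpredT) //=; apply: eq_bigr => j _.
have jN : (j <= N)%N by rewrite -ltnS.
have -> : ((N + j).+1 = (N - j) + (j + j).+1)%N by lia.
rewrite -cauchy_durfee mulr_sumr.
rewrite -(big_geq_mkord j N.+1 xpredT
  (fun n => q ^+ (n * n.+1) * h (N - n) * (alpha j * (h (n - j) * h (n + j).+1)))).
rewrite -{1}[nat_of_ord j]add0n big_addn subSn // big_mkord.
apply: eq_bigr => m _.
rewrite addnK -!subnDA.
have -> : ((m + j) * (m + j).+1 = j * j.+1 + m * (m + (j + j).+1))%N by lia.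
rewrite (addnC j m) exprD -addnA !addnS.
ring.
Qed.

(** Put [a_j = q^(j(j+1)/2) w_j]. The hypotheses say that
    [w_(j+1) + w_(j-1) = (s / q^(n+1)) w_j], with [w_(-1) = - w_0]: this holds for
    [w_j = z^(-j) - z^(j+1)], where [s = q^(n+1) (z + 1/z)], and the conclusion
    multiplies the sum by [(1 - z q^(n+1)) (1 - q^(n+1) / z)]. So it is the step
    of an inductive proof of the finite Jacobi triple product; as [z] does not
    occur in it, it also covers [w_j = 2j + 1], which is the case [z = 1]. The
    difference of the two sides telescopes. *)
Lemma bailey_recurrence (a : nat -> R) (s : R) n :
    s * a 0%N = q ^+ n * a 1%N - q ^+ n.+1 * a 0%N ->
    (forall j, (j < n)%N ->
       s * a j.+1 = q ^+ (n - j.+1) * a j.+2 + q ^+ (n + j).+2 * a j) ->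
  let S m := \sum_(j < m.+1) (-1) ^+ j * a j * (h (m - j) * h (m + j).+1) in
  (1 - q ^+ n.+1.*2) * (1 - q ^+ n.+1.*2.+1) * S n.+1
    = (1 + q ^+ n.+1.*2 - s) * S n.
Proof.
move=> s0 sS S.
(* [G J] is the telescoped difference of the first J + 1 terms. *)
pose G j := (-1) ^+ j * h (n - j) * (q ^+ (n - j) * a j.+1 * h (n + j).+1
              + q ^+ (n + j).+2 * a j * ((1 - q ^+ (n - j)) * h (n + j).+2)).
pose X := (1 - q ^+ n.+1.*2) * (1 - q ^+ n.+1.*2.+1).
pose Y := 1 + q ^+ n.+1.*2 - s.
have key J : (J <= n)%N ->
   \sum_(j < J.+1) (X * ((-1) ^+ j * a j * (h (n.+1 - j) * h (n.+1 + j).+1))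
     - Y * ((-1) ^+ j * a j * (h (n - j) * h (n + j).+1))) = G J.
  elim: J => [_|J IHJ Jn].
    rewrite big_ord1 /G /= !subn0 !addn0 !expr0.
    rewrite /Y [X in _ - X]mulrC !mulrDr mulrN.
    rewrite [X in _ - (_ - X)](_ : _ = (s * a 0%N) * (h n * h n.+1)); last by ring.
    rewrite s0 /X (qfactVS n) (qfactVS n.+1).
    rewrite -!muln2 !exprS exprM.
    ring.
  rewrite big_ord_recr /= IHJ 1?ltnW //.
  have [k nE] : exists k, n = (k + J.+1)%N by exists (n - J.+1)%N; lia.
  pose M := (k + J + J).+2; have sJ := sS J Jn; move: sJ.
  rewrite /G /Y /X.
  have -> : (n - J.+1 = k)%N by lia.
  have -> : (n.+1 - J.+1 = k.+1)%N by lia.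
  have -> : (n - J = k.+1)%N by lia.
  have -> : (n + J.+1 = M)%N by rewrite /M; lia.
  have -> : (n.+1 + J.+1 = M.+1)%N by rewrite /M; lia.
  have -> : (n + J = M.-1)%N by rewrite /M; lia.
  have -> : (M.-1.+1 = M)%N by [].
  move=> sJ.
  rewrite (_ : (1 + q ^+ n.+1.*2 - s) * _ = (-1) ^+ J.+1 * (h k * h M.+1)
     * ((1 + q ^+ n.+1.*2) * a J.+1 - s * a J.+1)); last by ring.
  rewrite sJ (qfactVS k) (qfactVS M) (qfactVS M.+1).
  have -> : (n.+1.*2 = (k + M).+2)%N by rewrite /M; lia.
  by rewrite /M !(exprS, exprD); ring.
rewrite -/X -/Y; apply/eqP; rewrite -subr_eq0 /S big_ord_recr mulrDr addrAC.
rewrite !mulr_sumr -sumrB key // /G !subnn expr0 subrr.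
rewrite [ord_max : nat]/= /X -addnn !(addSn, addnS).
rewrite (qfactVS (n + n).+1) (qfactVS (n + n).+2) !exprS.
by apply/eqP; ring.
Qed.

(** The case [z = q] of [bailey_recurrence]: at [n = 0] the factor
    [1 - q^(n+1) / z] vanishes, and the zero propagates. *)
Lemma unit_bailey_pair :
  bailey_pair (fun j => (-1) ^+ j * (q ^+ 'C(j, 2) * (1 - q ^+ j.*2.+1)))
              (fun n => (n == 0%N)%:R).
Proof.
elim=> [|n IHn].
  have h1 := qfactVS 0; rewrite qfactV0 in h1.
  by rewrite big_ord1 /= bin0n qfactV0 [LHS]h1; ring.
have cS j : 'C(j.+1, 2) = ('C(j, 2) + j)%N by rewrite binS bin1.
pose a j := q ^+ 'C(j, 2) * (1 - q ^+ j.*2.+1).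
have := @bailey_recurrence a (q ^+ n.+2 + q ^+ n) n; rewrite /= -IHn => rec.
have u : (1 - q ^+ n.+1.*2) * (1 - q ^+ n.+1.*2.+1) \is a GRing.unit.
  by rewrite unitrM !q_unit.
apply: (mulrI u).
rewrite rec {rec IHn}.
- have [->|n0] := eqVneq n 0%N; last by rewrite !mulr0.
  by rewrite /= mulr0; ring.
- by rewrite /a !bin_small // !exprS; ring.
move=> j lt_jn; rewrite /a !cS -!muln2.
have [k ->] : exists k, n = (k + j.+1)%N by exists (n - j.+1)%N; lia.
rewrite addnK !(mulSn, addnS, exprS, exprD, exprM); ring.
Qed.

(** The case [z = 1] of [bailey_recurrence], [w_j] being divided by [1 - z]
    beforehand, so that it becomes [2j + 1]. *)
Lemma jacobi_bailey_pair :
  bailey_pair (fun j => (-1) ^+ j * (q ^+ 'C(j.+1, 2) * j.*2.+1%:R))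
              (fun n => qpoch q q n ^+ 2 * h n.*2.+1).
Proof.
elim=> [|n IHn].
  by rewrite big_ord1 /= bin_small // /qpoch big_ord0 qfactV0 double0; ring.
have cS j : 'C(j.+1, 2) = ('C(j, 2) + j)%N by rewrite binS bin1.
pose a j : R := q ^+ 'C(j.+1, 2) * j.*2.+1%:R.
have := @bailey_recurrence a (q ^+ n.+1 *+ 2) n; rewrite /= -IHn => rec.
have u : (1 - q ^+ n.+1.*2) * (1 - q ^+ n.+1.*2.+1) \is a GRing.unit.
  by rewrite unitrM !q_unit.
apply: (mulrI u).
rewrite rec {rec IHn}.
- rewrite qpochS doubleS (qfactVS n.*2.+1) (qfactVS n.*2.+2).
  by rewrite -!muln2 !exprS exprM; ring.
- by rewrite /a binn bin_small // doubleS double0 !exprS; ring.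
move=> j lt_jn; rewrite /a !cS -!muln2.
have [k ->] : exists k, n = (k + j.+1)%N by exists (n - j.+1)%N; lia.
rewrite addnK !(mulSn, addnS, addSn, exprS, exprD, exprM) -!(natr1, natrM).
ring.
Qed.

(** The partial fraction expansion of [1 / (D_0 ... D_n)], where
    [D_j = (1 - x q^j) (1 - y q^j)]. As [x y = q], for every [m],
    [D_m = q^(m-j) D_j + (1 - q^(m-j)) (1 - q^(m+j+1))]. Hence [D_m] times the
    expansion for [m] is [q^m] times the sum of the unit pair, which is zero,
    plus the expansion for [m - 1]. *)
Lemma theta_bailey_pair x y : x * y = q ->
    (forall k, 1 - x * q ^+ k \is a GRing.unit) ->
    (forall k, 1 - y * q ^+ k \is a GRing.unit) ->
  bailey_pair
    (fun j => (-1) ^+ j * q ^+ 'C(j.+1, 2)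
       * ((1 - x * q ^+ j)^-1 + y * q ^+ j / (1 - y * q ^+ j)))
    (fun n => (qpoch x q n.+1 * qpoch y q n.+1)^-1).
Proof.
move=> xy ux uy.
pose D j := (1 - x * q ^+ j) * (1 - y * q ^+ j).
have uD j : D j \is a GRing.unit by rewrite unitrM ux uy.
have split_u j : (1 - x * q ^+ j)^-1 + y * q ^+ j / (1 - y * q ^+ j)
    = (1 - q ^+ j.*2.+1) / D j.
  apply: (mulIr (uD j)); rewrite divrK //.
  set u := 1 - x * _ ; set v := 1 - y * _.
  rewrite (_ : _ * D j = u^-1 * u * v + y * q ^+ j * (v^-1 * v) * u); last first.
    by rewrite /D -/u -/v; ring.
  by rewrite (mulVr (ux j)) (mulVr (uy j)) /u /v -addnn exprS exprD -{4}xy; ring.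
have uP n : qpoch x q n * qpoch y q n \is a GRing.unit.
  by rewrite unitrM; apply/andP; split; apply: rpred_prod.
have qpochD n : qpoch x q n.+1 * qpoch y q n.+1
    = qpoch x q n * qpoch y q n * D n by rewrite !qpochS /D; ring.
elim=> [|n IHn].
  have h1 := qfactVS 0; rewrite qfactV0 in h1.
  rewrite big_ord1 split_u qpochD bin_small // double0 /qpoch !big_ord0 qfactV0.
  rewrite !mul1r [RHS](_ : _ = (1 - q ^+ 1) * h 1 / D 0); last by ring.
  by rewrite -h1 mul1r.
apply: (mulrI (uD n.+1)); rewrite [in LHS]qpochD invrM // mulVKr // IHn.
have := unit_bailey_pair n.+1; rewrite /= => /(congr1 ( *%R (q ^+ n.+1))).
rewrite mulr0 mulr_sumr => unit0.
rewrite mulr_sumr; apply: etrans (esym (add0r _)) _; rewrite [X in X + _]unit0.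
set F := fun j => (-1) ^+ j * q ^+ 'C(j.+1, 2) * ((1 - q ^+ j.*2.+1) / D j).
rewrite [X in _ + X](_ : _ = \sum_(j < n.+2)
    F j * ((1 - q ^+ (n.+1 - j)) * h (n.+1 - j) * h (n + j).+1)); last first.
  rewrite [RHS]big_ord_recr /= subnn subrr !(mul0r, mulr0) addr0.
  apply: eq_bigr => j _; rewrite split_u subSn -1?ltnS //.
  by rewrite -qfactVS.
rewrite -big_split; apply: eq_bigr => j _ /=.
have cS : 'C(j.+1, 2) = ('C(j, 2) + j)%N by rewrite binS bin1.
rewrite split_u /F cS (qfactVS (n + j).+1) -addSn [D n.+1]/D.
have -> : q ^+ n.+1 = q ^+ (n.+1 - j) * q ^+ j by rewrite -exprD subnK // -ltnS.
have -> : q ^+ (n.+1 + j).+1 = q ^+ (n.+1 - j) * q ^+ j.*2.+1.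
  by rewrite -exprD; congr (_ ^+ _); move: (ltn_ord j); lia.
(* What remains is the formula for [D_m], with [w = q^(m-j)]. *)
set w := q ^+ (n.+1 - j); set c := h _; set d := h _; set g := _ / D j.
have -> : 1 - q ^+ j.*2.+1 = g * D j by rewrite divrK.
have -> : q ^+ j.*2.+1 = x * y * (q ^+ j * q ^+ j).
  by rewrite xy -exprD addnn exprS.
have -> : D j = 1 - x * q ^+ j - y * q ^+ j + x * y * (q ^+ j * q ^+ j).
  by rewrite /D; ring.
rewrite exprD; set e := _ ^+ j; set b := q ^+ j; set f := q ^+ 'C(j, 2).
move: e b f w c d g => e b f w c d g.
ring.
Qed.
End BaileyPairs.

(** * Limits, for a nilpotent q *)

Lemma unit_1sub_nilp (R : comUnitRingType) (t : R) n :
  t ^+ n = 0 -> 1 - t \is a GRing.unit.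
Proof.
move=> tn; apply/unitrPr; exists (\sum_(i < n) t ^+ i).
by rewrite -opprB mulNr -subrX1 tn sub0r opprK.
Qed.

Section Truncated.
Variables (R : comUnitRingType) (q : R) (N : nat).
Hypothesis qN : q ^+ N.+1 = 0.
Local Notation h := (qfactV q).

Lemma nilp_expr0 e : (N < e)%N -> q ^+ e = 0.
Proof. by move=> lt_Ne; rewrite -(subnK lt_Ne) exprD qN mulr0. Qed.

Lemma nilp_1subX_unit k : 1 - q ^+ k.+1 \is a GRing.unit.
Proof.
apply: (@unit_1sub_nilp _ _ N.+1).
by rewrite -exprM mulnC exprM qN expr0n.
Qed.
Local Notation q_unit := nilp_1subX_unit.

(** As [(q)_n] and [(q)_N] agree up to [q^n], their inverses become equal after
    multiplication by [q^e]. *)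
Lemma qfactV_stable e n : (N <= e + n)%N -> q ^+ e * h n = q ^+ e * h N.
Proof.
have up i k : (N <= e + k)%N -> q ^+ e * h k = q ^+ e * h (k + i)%N.
  elim: i => [|i IHi] Nk; first by rewrite addn0.
  rewrite IHi // addnS (qfactVS q_unit (k + i)) mulrA mulrBr mulr1 -exprD.
  by rewrite [q ^+ (e + _)]nilp_expr0 ?subr0 //; lia.
have [nN|/ltnW Nn] := leqP n N => Ne.
  by rewrite (up (N - n)%N) // subnKC.
by rewrite [RHS](up (n - N)%N) ?subnKC // leq_addl.
Qed.

Lemma qfactV_stableW n : (N <= n)%N -> h n = h N.
Proof. by move=> Nn; have := @qfactV_stable 0 n Nn; rewrite expr0 !mul1r. Qed.

(** The limit [N = oo] in the sums of Bailey's lemma and of Bailey pairs: the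
    growth of [e j] makes up for the low order to which [h (N - j)] agrees
    with [h N]. *)
Lemma bailey_sum_stable (a : nat -> R) (e : nat -> nat) :
  (forall j, j <= e j)%N ->
  \sum_(j < N.+1) q ^+ e j * a j * (h (N - j) * h (N + j).+1)
  = h N ^+ 2 * \sum_(j < N.+1) q ^+ e j * a j.
Proof.
move=> le_e; rewrite mulr_sumr; apply: eq_bigr => j _.
rewrite (@qfactV_stableW (N + j).+1) 1?leqW ?leq_addr //.
have /qfactV_stable E : (N <= e j + (N - j))%N by have := le_e j; lia.
rewrite (_ : _ * _ * _ = q ^+ e j * h (N - j) * (a j * h N)); last by ring.
by rewrite E; ring.
Qed.

Lemma qfactK n : qpoch q q n * h n = 1.
Proof. by rewrite mulrV ?qfact_unit //; apply: q_unit. Qed.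

(** Bailey's lemma for the unit pair. The [j]-th term stands for the pair of
    terms [q^(j(3j+1)/2)] and [q^((j+1)(3j+2)/2)] of Euler's series. *)
Lemma pentagonal_number_theorem :
  qpoch q q N
  = \sum_(j < N.+1) (-1) ^+ j * q ^+ (j * j.+1 + 'C(j, 2)) * (1 - q ^+ j.*2.+1).
Proof.
have := bailey_lemma q_unit N (unit_bailey_pair q_unit).
rewrite big_ord_recl big1 => [|i _]; last by rewrite mulr0.
rewrite /= expr0 !mul1r subn0 mulr1 addr0.
pose a j := (-1) ^+ j * (1 - q ^+ j.*2.+1).
pose e j := (j * j.+1 + 'C(j, 2))%N.
have le_e j : (j <= e j)%N by rewrite /e mulnS -!addnA leq_addr.
rewrite (eq_bigr (fun j : 'I_N.+1 =>
  q ^+ e j * a j * (h (N - j) * h (N + j).+1))); last first.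
  by move=> j _; rewrite /e /a exprD; ring.
rewrite (bailey_sum_stable _ le_e) => E.
rewrite -[LHS]mulr1 -[X in _ * X = _](qfactK N) [in LHS]E.
transitivity ((qpoch q q N * h N) ^+ 2 * \sum_(j < N.+1) q ^+ e j * a j).
  by ring.
rewrite qfactK expr1n mul1r; apply: eq_bigr => j _; rewrite /a /e; ring.
Qed.

(** The limit of the defining relation of [jacobi_bailey_pair]. *)
Lemma jacobi_cube :
  qpoch q q N ^+ 3 = \sum_(j < N.+1) (-1) ^+ j * q ^+ 'C(j.+1, 2) * j.*2.+1%:R.
Proof.
have := jacobi_bailey_pair q_unit N.
pose a j : R := (-1) ^+ j * j.*2.+1%:R.
have le_e j : (j <= 'C(j.+1, 2))%N by rewrite binS bin1 leq_addl.
rewrite (eq_bigr (fun j : 'I_N.+1 =>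
  q ^+ 'C(j.+1, 2) * a j * (h (N - j) * h (N + j).+1))); last first.
  by move=> j _; rewrite /a; ring.
rewrite (bailey_sum_stable _ le_e) qfactV_stableW; last by lia.
move=> E.
have -> : qpoch q q N ^+ 3 = qpoch q q N ^+ 3 * (qpoch q q N * h N) ^+ 2.
  by rewrite qfactK expr1n mulr1.
transitivity (qpoch q q N ^+ 3 * h N * (qpoch q q N ^+ 2 * h N)); first by ring.
rewrite E.
transitivity ((qpoch q q N * h N) ^+ 3
                * \sum_(j < N.+1) q ^+ 'C(j.+1, 2) * a j); first by ring.
rewrite qfactK expr1n mul1r; apply: eq_bigr => j _; rewrite /a; ring.
Qed.

Section Theta.
Variables x y : R.
Hypothesis xy : x * y = q.
Hypothesis ux : forall k, 1 - x * q ^+ k \is a GRing.unit.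
Hypothesis uy : forall k, 1 - y * q ^+ k \is a GRing.unit.
Let u j := (1 - x * q ^+ j)^-1 + y * q ^+ j / (1 - y * q ^+ j).

(** The limit of the defining relation of [theta_bailey_pair]. *)
Lemma reciprocal_theta :
  \sum_(j < N.+1) (-1) ^+ j * q ^+ 'C(j.+1, 2) * u j
  = qpoch q q N ^+ 2 / (qpoch x q N.+1 * qpoch y q N.+1).
Proof.
rewrite (theta_bailey_pair q_unit xy ux uy N) -/u.
pose a j : R := (-1) ^+ j * u j.
have le_e j : (j <= 'C(j.+1, 2))%N by rewrite binS bin1 leq_addl.
rewrite [in RHS](eq_bigr (fun j : 'I_N.+1 =>
  q ^+ 'C(j.+1, 2) * a j * (h (N - j) * h (N + j).+1))); last first.
  by move=> j _; rewrite /a /u; ring.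
rewrite (bailey_sum_stable _ le_e) mulrA -exprMn qfactK expr1n mul1r.
by apply: eq_bigr => j _; rewrite /a; ring.
Qed.

(** Bailey's lemma for [theta_bailey_pair]. The left side is the universal mock
    theta function [g_3(x; q)]. *)
Lemma universal_mock_theta :
  \sum_(n < N.+1) q ^+ (n * n.+1) / (qpoch x q n.+1 * qpoch y q n.+1)
  = h N * \sum_(j < N.+1) (-1) ^+ j * q ^+ (j * j.+1 + 'C(j.+1, 2)) * u j.
Proof.
have := bailey_lemma q_unit N (theta_bailey_pair q_unit xy ux uy).
rewrite (eq_bigr (fun n : 'I_N.+1 =>
  h N * (q ^+ (n * n.+1) / (qpoch x q n.+1 * qpoch y q n.+1)))); last first.
  move=> n _; rewrite qfactV_stable 1?mulrCA ?mulrA //.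
  by have := ltn_ord n; nia.
pose a j : R := (-1) ^+ j * u j.
pose e j := (j * j.+1 + 'C(j.+1, 2))%N.
have le_e j : (j <= e j)%N by rewrite /e mulnS -!addnA leq_addr.
rewrite [X in _ = X](eq_bigr (fun j : 'I_N.+1 =>
  q ^+ e j * a j * (h (N - j) * h (N + j).+1))); last first.
  by move=> j _; rewrite /e /a /u exprD; ring.
rewrite (bailey_sum_stable _ le_e) -mulr_sumr expr2 -mulrA.
have uh : h N \is a GRing.unit by rewrite unitrV qfact_unit //; apply: q_unit.
move=> /(mulrI uh) ->; congr (_ * _).
by apply: eq_bigr => j _; rewrite /a /e; ring.
Qed.
End Theta.
End Truncated.

(** * Truncated power series *)

(** A morphism which makes a power of ['X] vanish sees a polynomial only through
    its first coefficients; this is how the coefficient sequences [P_beta] and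
    [pbar] are turned into ring elements below. *)
Lemma rmorph_eq_coef (R : comNzRingType) (phi : {rmorphism {poly int} -> R}) n
    (p r : {poly int}) : phi 'X ^+ n = 0 ->
  (forall i, (i < n)%N -> p`_i = r`_i) -> phi p = phi r.
Proof.
move=> phiX pr; rewrite -(poly_take_drop n p) -(poly_take_drop n r).
rewrite !rmorphD !rmorphM !rmorphXn /= phiX !mulr0 !addr0; congr (phi _).
by apply/polyP => i; rewrite !coef_take_poly; case: ifP => // /pr.
Qed.

Section Truncation.
Variable n : nat.

(** Rational coefficients make the truncation a [comUnitRingType]. *)
Definition trunc :
    {rmorphism {poly int} -> {poly %/ ('X^(n.+1) : {poly rat})}} :=
  GRing.RMorphism.clone _ _ (in_qpoly 'X^(n.+1) \o map_poly intr) _.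

Lemma truncX : trunc 'X ^+ n.+1 = 0.
Proof.
rewrite -rmorphXn /= map_polyXn; apply: val_inj => /=.
by rewrite mk_monic_Xn Pdiv.RingMonic.rmodpp ?monicXn.
Qed.

Lemma trunc_inj p r i : trunc p = trunc r -> (i <= n)%N -> p`_i = r`_i.
Proof.
move=> /(congr1 val) /=; rewrite mk_monic_Xn /= => e le_in.
have low (f : {poly int}) :
    (Pdiv.CommonRing.rmodp (map_poly intr f) 'X^(n.+1))`_i = (f`_i)%:~R :> rat.
  rewrite -coef_map /=.
  rewrite [in RHS](Pdiv.RingMonic.rdivp_eq (monicXn _ n.+1) (map_poly intr f)).
  by rewrite coefD coefMXn ltnS le_in add0r.
by apply: (@intr_inj rat); rewrite -!low e.
Qed.

End Truncation.

(** * Overpartitions *)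

Definition opart_poly k b : {poly int} :=
  \prod_(i < k) \sum_(m < b) (0 < m).+1%:R * ('X^(i.+1)) ^+ m.

(** A choice of multiplicities with [k] positive entries carries [2^k] choices of
    overlined parts, which is the weight of its monomial in [opart_poly]. *)
Lemma pbarE n : pbar n = (opart_poly n n.+1)`_n.
Proof.
rewrite /opart_poly bigA_distr_bigA coef_sum /=.
pose wt (f : {ffun 'I_n -> 'I_n.+1}) := (\sum_(i < n) i.+1 * f i)%N.
pose supp (f : {ffun 'I_n -> 'I_n.+1}) := [set i | (0 < f i)%N]%SET.
transitivity (\sum_(f | wt f == n) (2 ^ #|supp f|)%N%:Z).
  rewrite -(big_morph Posz PoszD (erefl _)) /pbar; congr Posz.
  rewrite -sum1_card (eq_bigl (fun z : _ * {set 'I_n} =>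
    (wt z.1 == n) && (z.2 \subset supp z.1))).
    rewrite -(pair_big_dep (fun f => wt f == n)
      (fun f (A : {set 'I_n}) => A \subset supp f) (fun _ _ => 1%N)) /=.
    apply: eq_bigr => f _; rewrite -card_powerset -sum1_card.
    by apply: eq_bigl => A; rewrite powersetE.
  by move=> z; rewrite inE.
have prodE (f : {ffun 'I_n -> 'I_n.+1}) :
    \prod_(i < n) ((0 < f i)%N.+1%:R * 'X^(i.+1) ^+ f i)
    = (2 ^ #|supp f|)%:R * 'X^(wt f) :> {poly int}.
  rewrite big_split -natr_prod; congr (_%:R * _).
    rewrite -prod_nat_const [RHS]big_mkcond; apply: eq_bigr => i _.
    by rewrite inE; case: (0 < f i)%N.
  by rewrite -prodrXr; apply: eq_bigr => i _; rewrite exprM.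
rewrite [RHS](bigID (fun f => wt f == n)) /= [X in _ + X]big1 ?addr0.
  apply: eq_bigr => f /eqP wtf.
  by rewrite prodE mulr_natl coefMn coefXn wtf eqxx -natz.
move=> f; rewrite prodE mulr_natl coefMn coefXn eq_sym => /negbTE ->.
by rewrite mul0rn.
Qed.

(** This is [1 + 2 s + 2 s^2 + ...] as a fraction. *)
Lemma opart_factor (R : comUnitRingType) (s : R) n : s ^+ n.+1 = 0 ->
  \sum_(m < n.+1) (0 < m).+1%:R * s ^+ m = (1 + s) / (1 - s).
Proof.
move=> s0; have u := unit_1sub_nilp s0; apply: (mulIr u); rewrite divrK //.
rewrite big_ord_recl /= expr0 mulr1 mulrDl mul1r.
rewrite (eq_bigr (fun m : 'I_n => s *+ 2 * s ^+ m)); last first.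
  by move=> m _; rewrite /= exprS; ring.
have geom : (\sum_(m < n) s ^+ m) * (1 - s) = 1 - s ^+ n.
  by rewrite mulrC -opprB mulNr -subrX1 opprB.
rewrite -mulr_sumr -mulrA geom.
rewrite (_ : s *+ 2 * (1 - s ^+ n) = s *+ 2 - s * s ^+ n *+ 2); last by ring.
by rewrite -exprS s0; ring.
Qed.

Lemma opart_poly_morph (R : comUnitRingType) (phi : {rmorphism {poly int} -> R})
    k n : phi 'X ^+ n.+1 = 0 ->
  phi (opart_poly k n.+1)
  = \prod_(i < k) ((1 + phi 'X ^+ i.+1) / (1 - phi 'X ^+ i.+1)).
Proof.
move=> phiX; rewrite rmorph_prod; apply: eq_bigr => i _.
rewrite rmorph_sum -(@opart_factor _ _ n); last first.
  by rewrite -exprM mulnC exprM phiX expr0n.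
by apply: eq_bigr => m _; rewrite rmorphM !rmorphXn rmorph_nat.
Qed.

(** In the truncation at order [n] the factors with [i >= n] become 1, so that
    the number of factors and the bound on multiplicities can be made uniform
    in [n]. *)
Lemma coef_opart_poly n N : (n <= N)%N ->
  (opart_poly N N.+1)`_n = (opart_poly n n.+1)`_n.
Proof.
move=> nN; apply: (@trunc_inj n _ _ n) => //.
have tX := truncX n; rewrite !opart_poly_morph ?(nilp_expr0 tX) //.
rewrite -(big_mkord xpredT
  (fun i => (1 + trunc n 'X ^+ i.+1) / (1 - trunc n 'X ^+ i.+1))).
rewrite (big_cat_nat (leq0n n) nN) /= big_mkord [X in _ * X]big_nat_cond.
rewrite [X in _ * X]big1 ?mulr1 // => i /andP[/andP[ni _] _].
by rewrite (nilp_expr0 tX) // addr0 subr0 divr1.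
Qed.

(** The generating function [(-q; q)_oo / (q)_oo], written with
    [1 + q^k = (1 - q^(2k)) / (1 - q^k)]. *)
Lemma overpartition_gf (R : comUnitRingType) (phi : {rmorphism {poly int} -> R})
    N : phi 'X ^+ N.+1 = 0 ->
  phi (\poly_(i < N.+1) pbar i)
  = qpoch (phi 'X ^+ 2) (phi 'X ^+ 2) N * qfactV (phi 'X) N ^+ 2.
Proof.
move=> phiX; rewrite (@rmorph_eq_coef _ _ N.+1 _ (opart_poly N N.+1)) //; last first.
  by move=> i iN; rewrite coef_poly iN pbarE coef_opart_poly.
rewrite opart_poly_morph // /qfactV /qpoch -prodrV; last first.
  by move=> i _; rewrite -exprS (nilp_1subX_unit phiX).
rewrite -prodrXl -big_split; apply: eq_bigr => i _ /=.
have u := nilp_1subX_unit phiX i.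
rewrite -!exprS -exprM mulnC exprM.
set t := phi 'X ^+ _ in u *.
rewrite (_ : 1 - t ^+ 2 = (1 + t) * (1 - t)); last by ring.
by rewrite expr2 mulrA mulrK.
Qed.

(** * Coefficients *)

Lemma fsum_ge_nat (a N : nat) (F : nat -> int) :
    (forall i, (N <= i)%N -> F i = 0) ->
  \sum_(i \in [set i | (a <= i)%N]%classic) F i = \sum_(a <= i < N) F i.
Proof.
move=> F0; rewrite (fsbigE (index_iota a N)) ?iota_uniq //.
- rewrite big_nat_cond [RHS]big_nat_cond; apply: eq_bigl => i.
  by have [ai|//] := boolP (a <= i)%N; rewrite mem_set.
- by move=> i /=; rewrite mem_index_iota => /andP[].
by move=> i /= ai; rewrite mem_index_iota ai -leqNgt; apply: F0.
Qed.

Lemma fsum_nat (N : nat) (F : nat -> int) :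
    (forall i, (N <= i)%N -> F i = 0) ->
  \sum_(i \in [set: nat]%classic) F i = \sum_(i < N) F i.
Proof.
move=> /fsum_ge_nat E; rewrite -(big_mkord xpredT) -E; apply: eq_fsbigl.
by apply/seteqP; split.
Qed.

Lemma coef_XnM_poly (f : nat -> int) L e i : (i < L)%N ->
  ('X^e * \poly_(i < L) f i)`_i = ext0 f (i%:Z - e%:Z).
Proof.
move=> iL; rewrite coefXnM; case: ltnP => [ie|ei].
  by case E: (i%:Z - e%:Z) => [m|m] //=; move: E; lia.
by rewrite coef_poly (leq_ltn_trans (leq_subr _ _) iL) subzn.
Qed.

Lemma coef_XnM_comp_poly (p : {poly int}) a n : (a < 3)%N ->
  ('X^(a.+1) * (p \Po 'X^3))`_(3 * n + 1) = if a == 0%N then p`_n else 0.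
Proof.
move=> a3; rewrite coefXnM coef_comp_poly_Xn //.
case: a a3 => [|a] a3 /=.
  by rewrite ltnNge leq_addl /= addnK dvdn_mulr // mulKn.
case: ltnP => // an; rewrite (_ : (3 %| _)%N = false) //.
by apply/negP => /dvdnP[k]; lia.
Qed.

(** * The mock theta function beta *)

Lemma fps_div_morph (R : comUnitRingType) (phi : {rmorphism {poly int} -> R}) L
    (c d : {poly int}) : phi 'X ^+ L = 0 -> d`_0 = 1 ->
  phi (\poly_(i < L) fps_div c d i) = phi c / phi d.
Proof.
move=> phiX d0.
have divE b : phi d * phi (\poly_(i < L) fps_div b d i) = phi b.
  rewrite -rmorphM; apply: (rmorph_eq_coef phiX) => i iL.
  rewrite -(fps_divP b i d0) coefM; apply: eq_bigr => j _.
  by rewrite coef_poly (leq_ltn_trans (leq_subr _ _) iL).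
have ud : phi d \is a GRing.unit.
  by apply/unitrPr; exists (phi (\poly_(i < L) fps_div 1 d i)); rewrite divE rmorph1.
by apply: (mulrI ud); rewrite divE mulrCA mulrV // mulr1.
Qed.

Lemma P_betaE n i : (i <= 3 * n + 2)%N ->
  P_beta i = \sum_(k < n.+1) beta_term k i.
Proof. by move=> ni; apply: fsum_nat => k nk; apply: beta_term_eq0; nia. Qed.

Lemma qpoch_morph (R S : comNzRingType) (phi : {rmorphism R -> S}) (b p : R) n :
  phi (qpoch b p n) = qpoch (phi b) (phi p) n.
Proof.
rewrite rmorph_prod; apply: eq_bigr => i _.
by rewrite rmorphB rmorph1 rmorphM rmorphXn.
Qed.

Lemma beta_morph (R : comUnitRingType) (phi : {rmorphism {poly int} -> R}) n :
    phi 'X ^+ (3 * n + 3) = 0 -> let q := phi 'X in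
  phi (\poly_(i < 3 * n + 3) P_beta i)
  = q * \sum_(k < n.+1) (q ^+ 3) ^+ (k * k.+1)
          / (qpoch q (q ^+ 3) k.+1 * qpoch (q ^+ 2) (q ^+ 3) k.+1).
Proof.
move=> phiX q.
have -> : \poly_(i < 3 * n + 3) P_beta i
    = \sum_(k < n.+1) \poly_(i < 3 * n + 3) beta_term k i.
  apply/polyP => i; rewrite coef_sum coef_poly; case: ifP => [i_lt|i_ge].
    have i_le : (i <= 3 * n + 2)%N by lia.
    by rewrite (P_betaE i_le); apply: eq_bigr => k _; rewrite coef_poly i_lt.
  by rewrite big1 // => k _; rewrite coef_poly i_ge.
rewrite rmorph_sum mulr_sumr; apply: eq_bigr => k _.
rewrite (fps_div_morph _ phiX) ?beta_den0 // rmorphM !qpoch_morph !rmorphXn -/q.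
rewrite mulrA -exprM -exprS; congr (q ^+ _ / _); lia.
Qed.

Lemma qpoch_trisect (R : comNzRingType) (q : R) m :
  qpoch q (q ^+ 3) m * qpoch (q ^+ 2) (q ^+ 3) m * qpoch (q ^+ 3) (q ^+ 3) m
  = qpoch q q (3 * m).
Proof.
elim: m => [|m IHm]; first by rewrite /qpoch !big_ord0 !mulr1.
rewrite mulnS addnC addn3 !qpochS -IHm.
have e1 : q ^+ (3 * m).+1 = q * (q ^+ 3) ^+ m by rewrite exprS exprM.
have e2 : q ^+ (3 * m).+2 = q * (q * (q ^+ 3) ^+ m) by rewrite exprS e1.
by rewrite e2 e1 exprM; ring.
Qed.

(** To be a series in [q^3] will mean to lie in the image of a morphism [psi] which
    sends ['X] to [q^3]. *)
Section RmorphismImage.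
Variables (R : nzRingType) (S : comUnitRingType) (psi : {rmorphism R -> S}).

Definition in_image (w : S) := exists p, w = psi p.

Lemma in_imageD v w : in_image v -> in_image w -> in_image (v + w).
Proof. by move=> [p ->] [r ->]; exists (p + r); rewrite rmorphD. Qed.

Lemma in_imageM v w : in_image v -> in_image w -> in_image (v * w).
Proof. by move=> [p ->] [r ->]; exists (p * r); rewrite rmorphM. Qed.

Lemma in_imageX v m : in_image v -> in_image (v ^+ m).
Proof. by move=> [p ->]; exists (p ^+ m); rewrite rmorphXn. Qed.

Lemma in_image_sign m : in_image ((-1) ^+ m).
Proof. by exists ((-1) ^+ m); rewrite rmorph_sign. Qed.

Lemma in_image_sum m (F : 'I_m -> S) :
  (forall i, in_image (F i)) -> in_image (\sum_(i < m) F i).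
Proof.
move=> FP; apply: big_ind => //; first by exists 0; rewrite rmorph0.
exact: in_imageD.
Qed.

Lemma in_image_prod m (F : 'I_m -> S) :
  (forall i, in_image (F i)) -> in_image (\prod_(i < m) F i).
Proof.
move=> FP; apply: big_ind => //; first by exists 1; rewrite rmorph1.
exact: in_imageM.
Qed.

Lemma in_image_inv1sub v m : v ^+ m = 0 -> in_image v -> in_image (1 - v)^-1.
Proof.
move=> vm vP; have u := unit_1sub_nilp vm.
rewrite (_ : _^-1 = \sum_(i < m) v ^+ i).
  by apply: in_image_sum => i; apply: in_imageX.
by apply: (mulrI u); rewrite mulrV // -opprB mulNr -subrX1 vm sub0r opprK.
Qed.
End RmorphismImage.

Lemma triangularE j : ('C(j.+1, 2) * 2 = j * j.+1)%N.
Proof. by elim: j => // j IHj; rewrite binS bin1; lia. Qed.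

(** * Trisection of beta *)

Lemma inv_1sub_trisect (R : comUnitRingType) (t : R) :
    1 - t \is a GRing.unit -> 1 - t ^+ 3 \is a GRing.unit ->
  (1 - t)^-1 = (1 + t + t ^+ 2) / (1 - t ^+ 3).
Proof.
move=> u1 u3; apply: (mulrI u1); rewrite mulrV // mulrA.
by rewrite (_ : (1 - t) * _ = 1 - t ^+ 3) ?mulrV //; ring.
Qed.

(** The part of beta with exponents 1 modulo 3 is found explicitly; of the two
    other ones it only matters that they are series in [q^3], times [q^2]
    and [q^3]. *)
Lemma beta_trisection (R : comUnitRingType)
    (phi psi : {rmorphism {poly int} -> R}) n :
    phi 'X ^+ (3 * n + 3) = 0 -> psi 'X = phi 'X ^+ 3 -> let q := phi 'X in
  exists g1 g2,
  phi (\poly_(i < 3 * n + 3) P_beta i)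
  = q * (qfactV (q ^+ 3) n ^+ 2 * qpoch ((q ^+ 3) ^+ 3) ((q ^+ 3) ^+ 3) n ^+ 3)
    + q ^+ 2 * psi g1 + q ^+ 3 * psi g2.
Proof.
move=> phiX psiX q; rewrite (beta_morph phiX) -/q.
set Q := q ^+ 3; set P := Q ^+ 3.
have q0 : q ^+ (3 * n + 3).-1.+1 = 0 by rewrite addnS /= -addnS.
have Qn : Q ^+ n.+1 = 0 by rewrite -exprM mulnS addnC.
have Pn : P ^+ n.+1 = 0 by rewrite -exprM mulnC exprM Qn expr0n.
have uq e : 1 - q ^+ e.+1 \is a GRing.unit := nilp_1subX_unit q0 e.
have xq k : q * Q ^+ k = q ^+ (3 * k).+1 by rewrite exprS exprM.
have yq k : q ^+ 2 * Q ^+ k = q ^+ (3 * k).+2 by rewrite !exprS exprM; ring.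
have xQ k : Q * P ^+ k = q ^+ (9 * k + 2).+1.
  by rewrite /P /Q -!exprM -exprD; congr (_ ^+ _); lia.
have yQ k : Q ^+ 2 * P ^+ k = q ^+ (9 * k + 5).+1.
  by rewrite /P /Q -!exprM -exprD; congr (_ ^+ _); lia.
have uxq k : 1 - q * Q ^+ k \is a GRing.unit by rewrite xq uq.
have uyq k : 1 - q ^+ 2 * Q ^+ k \is a GRing.unit by rewrite yq uq.
have uxQ k : 1 - Q * P ^+ k \is a GRing.unit by rewrite xQ uq.
have uyQ k : 1 - Q ^+ 2 * P ^+ k \is a GRing.unit by rewrite yQ uq.
rewrite (universal_mock_theta Qn _ uxq uyq) -?exprS //.
(* The trisection [u_j = v_j + q w1_j + q^2 w2_j]: [v_j] is a [u_j] for
   [(Q, Q^2, Q^3)]. *)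
pose v j := (1 - Q * P ^+ j)^-1 + Q ^+ 2 * P ^+ j / (1 - Q ^+ 2 * P ^+ j).
pose w1 j := Q ^+ j * (1 - Q * P ^+ j)^-1
  + Q * Q ^+ j ^+ 2 * (1 - Q ^+ 2 * P ^+ j)^-1.
pose w2 j := Q ^+ j ^+ 2 * (1 - Q * P ^+ j)^-1
  + Q ^+ j * (1 - Q ^+ 2 * P ^+ j)^-1.
have uE j : (1 - q * Q ^+ j)^-1 + q ^+ 2 * Q ^+ j / (1 - q ^+ 2 * Q ^+ j)
    = v j + q * w1 j + q ^+ 2 * w2 j.
  have PE : P ^+ j = Q ^+ j ^+ 3 by rewrite /P exprAC.
  have e1 : (q * Q ^+ j) ^+ 3 = Q * P ^+ j by rewrite PE exprMn.
  have e2 : (q ^+ 2 * Q ^+ j) ^+ 3 = Q ^+ 2 * P ^+ j.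
    by rewrite PE exprMn [q ^+ 2 ^+ 3]exprAC.
  rewrite inv_1sub_trisect ?e1 // (inv_1sub_trisect (uyq j)) ?e2 // -e1 -e2.
  rewrite /v /w1 /w2 -e1 -e2 /Q.
  ring.
pose c j : R := (-1) ^+ j * P ^+ 'C(j.+1, 2).
(* The product [(Q; P)_oo (Q^2; P)_oo (P; P)_oo] is [(Q; Q)_oo]. *)
have thetaE : \sum_(j < n.+1) c j * v j = qpoch P P n ^+ 3 * qfactV Q n.
  rewrite (reciprocal_theta Pn _ uxQ uyQ) -?exprS //.
  rewrite [qpoch P P n ^+ 3]exprSr -mulrA; congr (_ * _).
  have uPP : qpoch P P n.+1 \is a GRing.unit := qfact_unit (nilp_1subX_unit Pn) _.
  rewrite -(@qfactV_stableW _ _ _ Qn (3 * n.+1)); last by lia.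
  have uxy : qpoch Q P n.+1 * qpoch (Q ^+ 2) P n.+1 \is a GRing.unit.
    by rewrite unitrM; apply/andP; split; apply: rpred_prod.
  rewrite /qfactV -qpoch_trisect -/P (invrM uxy uPP).
  have <- : qpoch P P n.+1 = qpoch P P n by rewrite qpochS -exprS Pn subr0 mulr1.
  by rewrite mulVKr.
have in_Q : in_image psi Q by exists 'X; rewrite psiX.
have in_Qj j : in_image psi (Q ^+ j) by apply: in_imageX.
have in_P j : in_image psi (P ^+ j) by apply: in_imageX; apply: in_imageX.
have in_inv w : in_image psi w -> in_image psi (1 - Q * w)^-1.
  move=> in_w; apply: (@in_image_inv1sub _ _ _ _ n.+1); last exact: in_imageM.
  by rewrite exprMn Qn mul0r.
have in_invx j : in_image psi (1 - Q * P ^+ j)^-1 by apply: in_inv.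
have in_invy j : in_image psi (1 - Q ^+ 2 * P ^+ j)^-1.
  by rewrite expr2 -mulrA; apply: in_inv; apply: in_imageM.
have in_h : in_image psi (qfactV Q n).
  rewrite /qfactV /qpoch -prodrV; last first.
    by move=> i _; rewrite -exprS (nilp_1subX_unit Qn).
  by apply: in_image_prod => i; apply: in_inv.
have in_c j : in_image psi (c j) by apply: in_imageM => //; apply: in_image_sign.
have [g1 g1E] : in_image psi (qfactV Q n * \sum_(j < n.+1) c j * w1 j).
  apply: in_imageM => //; apply: in_image_sum => j; apply: in_imageM => //.
  apply: in_imageD; apply: in_imageM => //.
  by apply: in_imageM => //; apply: in_imageX.
have [g2 g2E] : in_image psi (qfactV Q n * \sum_(j < n.+1) c j * w2 j).
  apply: in_imageM => //; apply: in_image_sum => j; apply: in_imageM => //.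
  by apply: in_imageD; apply: in_imageM => //; apply: in_imageX.
exists g1, g2; rewrite -g1E -g2E.
rewrite (eq_bigr (fun j : 'I_n.+1 =>
    c j * v j + q * (c j * w1 j) + q ^+ 2 * (c j * w2 j))); last first.
  move=> j _; rewrite uE /c.
  have -> : P ^+ 'C(j.+1, 2) = Q ^+ (3 * 'C(j.+1, 2)) by rewrite exprM.
  have -> : (3 * 'C(j.+1, 2) = j * j.+1 + 'C(j.+1, 2))%N.
    by have := triangularE j; lia.
  by ring.
rewrite !big_split /= -!mulr_sumr thetaE.
move: (qfactV Q n) (qpoch P P n) (\sum_(_ < _) _) (\sum_(_ < _) _) => h pr s1 s2.
by rewrite /Q; ring.
Qed.

(** * Comparison of coefficients *)

(** Euler's pentagonal series in [q^b]. *)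
Definition pent_poly (b n : nat) : {poly int} := \sum_(j < n.+1)
  (-1) ^+ j * 'X^b ^+ (j * j.+1 + 'C(j, 2)) * (1 - 'X^b ^+ j.*2.+1).

(** Jacobi's series for [(q^3; q^3)_oo^3]. *)
Definition cube_poly (n : nat) : {poly int} :=
  \sum_(j < n.+1) (-1) ^+ j * 'X^3 ^+ 'C(j.+1, 2) * j.*2.+1%:R.

Lemma pent_poly_morph (R : comUnitRingType)
    (phi : {rmorphism {poly int} -> R}) b n : (phi 'X ^+ b) ^+ n.+1 = 0 ->
  phi (pent_poly b n) = qpoch (phi 'X ^+ b) (phi 'X ^+ b) n.
Proof.
move=> phiX; rewrite (pentagonal_number_theorem phiX) rmorph_sum.
apply: eq_bigr => j _.
by rewrite !rmorphM rmorph_sign rmorphB rmorph1 !(rmorphXn phi).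
Qed.

Lemma cube_poly_morph (R : comUnitRingType)
    (phi : {rmorphism {poly int} -> R}) n : (phi 'X ^+ 3) ^+ n.+1 = 0 ->
  phi (cube_poly n) = qpoch (phi 'X ^+ 3) (phi 'X ^+ 3) n ^+ 3.
Proof.
move=> phiX; rewrite (jacobi_cube phiX) rmorph_sum.
apply: eq_bigr => j _.
by rewrite !rmorphM rmorph_sign rmorph_nat !(rmorphXn phi).
Qed.

(** The theorem is the comparison of the coefficients of [q^(3n+1)]: the terms
    with [g1] and [g2] have no exponent congruent to 1 modulo 3. *)
Lemma pent_beta_morph (R : comUnitRingType)
    (phi : {rmorphism {poly int} -> R}) n : phi 'X ^+ (3 * n + 3) = 0 ->
  exists g1 g2,
  phi (pent_poly 6 n * \poly_(i < 3 * n + 3) P_beta i)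
  = phi ('X^1 * ((cube_poly n * \poly_(i < n.+1) pbar i) \Po 'X^3)
         + 'X^2 * (g1 \Po 'X^3) + 'X^3 * (g2 \Po 'X^3)).
Proof.
move=> phiX; set q := phi 'X in phiX *.
pose psi : {rmorphism {poly int} -> R} :=
  GRing.RMorphism.clone _ _ (phi \o comp_poly 'X^3) _.
have psiX : psi 'X = q ^+ 3 by rewrite /= comp_polyX rmorphXn.
have [g1 [g2]] := beta_trisection phiX psiX; rewrite -/q => betaE.
have Qn : (q ^+ 3) ^+ n.+1 = 0 by rewrite -exprM mulnS addnC.
have nilpX m : (q ^+ 3) ^+ m.+1 ^+ n.+1 = 0.
  by rewrite -exprM mulnC exprM Qn expr0n.
have := overpartition_gf (phi := psi) (N := n); rewrite psiX => /(_ Qn) ovpE.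
have := cube_poly_morph (phi := psi) (n := n).
rewrite psiX => /(_ (nilpX _)) cubeE.
have := pent_poly_morph (phi := psi) (b := 2) (n := n).
rewrite psiX => /(_ (nilpX _)) pent2E.
have pent6E : phi (pent_poly 6 n) = psi (pent_poly 2 n).
  rewrite pent2E -exprM; apply: pent_poly_morph.
  by rewrite (exprM _ 3 2); apply: nilpX.
exists (pent_poly 2 n * g1), (pent_poly 2 n * g2).
rewrite 2!(rmorphD phi) !(rmorphM phi) !(rmorphXn phi) -/q betaE pent6E.
rewrite -![phi (_ \Po _)]/(psi _) !(rmorphM psi) cubeE ovpE pent2E.
ring.
Qed.

Lemma coef_signM (p : {poly int}) j i : ((-1) ^+ j * p)`_i = (-1) ^+ j * p`_i.
Proof. by rewrite -(rmorph_sign polyC) coefCM. Qed.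

Lemma coef_pent_poly_mul b n (f : nat -> int) L i : (i < L)%N ->
  (pent_poly b n * \poly_(i < L) f i)`_i
  = \sum_(j < n.+1) (-1) ^+ j * ext0 f (i%:Z - (b * (j * j.+1 + 'C(j, 2)))%N%:Z)
    - \sum_(j < n.+1) (-1) ^+ j
        * ext0 f (i%:Z - (b * (j * j.+1 + 'C(j, 2) + j.*2.+1))%N%:Z).
Proof.
move=> iL; rewrite mulr_suml coef_sum -sumrB; apply: eq_bigr => j _.
set B := \poly_(_ < _) _; rewrite -!exprM.
rewrite (_ : _ * B = (-1) ^+ j * ('X^(b * (j * j.+1 + 'C(j, 2))) * B
  - 'X^(b * (j * j.+1 + 'C(j, 2) + j.*2.+1)) * B)).
  by rewrite coef_signM coefB !coef_XnM_poly // mulrBr.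
rewrite !mulnDr !exprD; ring.
Qed.

Lemma coef_cube_poly_mul n (f : nat -> int) L i : (i < L)%N ->
  (cube_poly n * \poly_(i < L) f i)`_i
  = \sum_(j < n.+1) (-1) ^+ j * j.*2.+1%:R
      * ext0 f (i%:Z - (3 * 'C(j.+1, 2))%N%:Z).
Proof.
move=> iL; rewrite mulr_suml coef_sum; apply: eq_bigr => j _.
rewrite -exprM -!mulrA coef_signM; congr (_ * _).
by rewrite mulrCA !mulr_natl coefMn coef_XnM_poly.
Qed.

Lemma ext0_lt0 (f : nat -> int) m : m < 0 -> ext0 f m = 0.
Proof. by case: m. Qed.

Theorem theorem5p6 (n : nat) :
  ext0 P_beta (3 * n%:Z + 1)
  + \sum_(m \in [set m : nat | (1 <= m)%N]%classic)
      (-1) ^+ m * ext0 P_beta (3 * n%:Z - 3 * m%:Z * (3 * m%:Z + 1) + 1)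
  + \sum_(m \in [set m : nat | (1 <= m)%N]%classic)
      (-1) ^+ m * ext0 P_beta (3 * n%:Z - 3 * m%:Z * (3 * m%:Z - 1) + 1)
  = \sum_(k \in [set: nat]%classic)
      (-1) ^+ k * (2 * k%:Z + 1)
        * ext0 pbar (n%:Z - (3 * k * (k + 1) %/ 2)%N%:Z).
Proof.
have phiX : trunc (3 * n + 2) 'X ^+ (3 * n + 3) = 0.
  by rewrite [(3 * n + 3)%N]addnS; apply: truncX.
have [g1 [g2 main]] := pent_beta_morph phiX.
have := trunc_inj main (_ : 3 * n + 1 <= 3 * n + 2)%N.
rewrite leq_add2l => /(_ isT).
rewrite coefD coefD !coef_XnM_comp_poly //= !addr0 => coefE.
rewrite coef_pent_poly_mul 1?coef_cube_poly_mul in coefE; try lia.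
(* The terms of the second sum are those with exponent 3m(3m - 1), for m > 0;
   they are shifted to j = m - 1, hence the bound n + 2. *)
rewrite (@fsum_ge_nat _ n.+1); last first.
  by move=> m nm; rewrite ext0_lt0 ?mulr0 //; nia.
rewrite (@fsum_ge_nat _ n.+2); last first.
  by move=> m nm; rewrite ext0_lt0 ?mulr0 //; nia.
rewrite (@fsum_nat n.+1); last first.
  by move=> m nm; rewrite ext0_lt0 ?mulr0 //; nia.
transitivity (
    \sum_(0 <= m < n.+1) (-1) ^+ m
      * ext0 P_beta (3 * n%:Z - 3 * m%:Z * (3 * m%:Z + 1) + 1)
  + \sum_(0 <= m < n.+1) (-1) ^+ m.+1
      * ext0 P_beta (3 * n%:Z - 3 * m.+1%:Z * (3 * m.+1%:Z - 1) + 1)).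
  congr (_ + _); last by rewrite big_add1.
  by rewrite [RHS]big_ltn // expr0 mul1r mulr0 mul0r subr0.
rewrite !big_mkord.
have tri0 j : ('C(j, 2) * 2 = j * j.-1)%N.
  by case: j => // j; rewrite triangularE mulnC.
rewrite [RHS](eq_bigr (fun j : 'I_n.+1 => (-1) ^+ j * j.*2.+1%:R
  * ext0 pbar (n%:Z - (3 * 'C(j.+1, 2))%N%:Z))).
  rewrite -coefE -sumrN; congr (_ + _); apply: eq_bigr => j _.
    by congr (_ * ext0 _ _); have := tri0 j; nia.
  rewrite exprS mulN1r mulNr; congr (- (_ * ext0 _ _)).
  by have := tri0 j; nia.
move=> j _; congr (_ * _ * ext0 _ _); first by lia.
by have := triangularE j; nia.
Qed.
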